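(* Let $n\ge 1$, $k\ge 1$ and $t\ge r\ge 1$ be integers. Then $$\gamma_{t,r}(C_n^{(k)})=\begin{cases}1 & \text{if } n\le 2(t-r)k+1,\\ 2 & \text{if } 2(t-r)k+1<n\le (2t-r-1)k+1,\\ \left\lceil \frac{n}{(2t-r-1)k+1}\right\rceil & \text{if } n>(2t-r-1)k+1.\end{cases}$$
   Context: $C_n^{(k)}$ is the $k$-th power of the cycle on $n$ vertices: its vertex set is $\{v_0,\dots,v_{n-1}\}$ (indices mod $n$) and $v_iv_j$ is an edge iff $v_i\ne v_j$ and the cyclic distance $\min\{|i-j|,n-|i-j|\}$ is at most $k$. For a graph $G$ with graph distance $d$ and positive integers $t,r$, a set $\mathcal{T}\subseteq V(G)$ of towers is $(t,r)$ broadcast dominating if every vertex $v$ satisfies $\sum_{u\in\mathcal{T}}\max\{0,t-d(u,v)\}\ge r$. The $(t,r)$ broadcast domination number $\gamma_{t,r}(G)$ is the minimum cardinality of a $(t,r)$ broadcast dominating set. *)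

(* Defs.v *)
From HB Require Import structures.
From mathcomp Require Import all_boot all_order all_algebra.

Set Implicit Arguments.
Unset Strict Implicit.
Unset Printing Implicit Defensive.

Record sgraph := SGraph {
  vertex :> finType;
  edge : rel vertex;
  edge_sym : symmetric edge;
  edge_irr : irreflexive edge
}.

Section Broadcast.

Variable G : sgraph.
Implicit Types (u v : G) (S : {set G}).

Definition walk (m : nat) u v : bool :=
  [exists p : m.-tuple G, path (@edge G) u p && (last u p == v)].

(* The graph distance, with None standing for infinity.  Searching lengths
   below #|G| is enough, since a shortest walk is a path: see gdistP and
   gdist_None. *)
Definition gdist u v : option nat :=
  let m := find (fun m => walk m u v) (iota 0 #|G|) in
  if m < #|G| then Some m else None.

(* Truncated subtraction is max(0, t - d); a tower transmits nothing to a
   vertex at infinite distance. *)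
Definition signal (t : nat) u v : nat :=
  if gdist u v is Some d then t - d else 0.

Definition broadcast_dominating (t r : nat) S : bool :=
  [forall v, r <= \sum_(u in S) signal t u v].

(* If no dominating set exists, this takes the junk value #|G|; that does not
   happen when r <= t, by broadcast_dominatingT. *)
Definition broadcast_number (t r : nat) : nat :=
  #|[arg min_(S < [set: G] | broadcast_dominating t r S) #|S|]|.

Lemma walkP m u v :
  reflect (exists p, [/\ path (@edge G) u p, last u p = v & size p = m])
          (walk m u v).
Proof.
apply: (iffP existsP) => [[p /andP[up /eqP lp]]|[p [up lp /eqP sp]]].
  by exists p; rewrite size_tuple.
by exists (Tuple sp); rewrite /= up lp eqxx.
Qed.

Lemma walk_bound m u v :
  walk m u v -> exists m', [/\ m' <= m, m' < #|G| & walk m' u v].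
Proof.
case/walkP=> p [up lp <-]; move: lp; case/shortenP: up => q uq q_uniq sub lq.
exists (size q); split; last by apply/walkP; exists q.
  by apply: uniq_leq_size => //; case/andP: q_uniq.
by rewrite -[(size q).+1]/(size (u :: q)) -(card_uniqP q_uniq) max_card.
Qed.

Lemma gdistP m u v :
  gdist u v = Some m <->
  walk m u v /\ (forall m', walk m' u v -> m <= m').
Proof.
rewrite /gdist; set a := fun m => walk m u v.
have szI : size (iota 0 #|G|) = #|G| by rewrite size_iota.
have minf j : j < #|G| -> walk j u v -> find a (iota 0 #|G|) <= j.
  move=> ltj wj; rewrite leqNgt; apply/negP => /(before_find 0).
  by rewrite nth_iota // add0n /a wj.
split.
  case: ifP => // ltf [<-]; split=> [|m'].
    have hasa : has a (iota 0 #|G|) by rewrite has_find szI.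
    by have := nth_find 0 hasa; rewrite nth_iota.
  by case/walk_bound=> j [jm' ltj wj]; apply: leq_trans jm'; apply: minf.
case=> wm minm; have [j [jm ltj wj]] := walk_bound wm.
have ltf : find a (iota 0 #|G|) < #|G| by apply: leq_ltn_trans (minf _ ltj wj) _.
rewrite ltf; congr Some; apply/eqP; rewrite eqn_leq.
rewrite (leq_trans (minf _ ltj wj) jm) /= minm //.
have hasa : has a (iota 0 #|G|) by rewrite has_find szI.
by have := nth_find 0 hasa; rewrite nth_iota.
Qed.

Lemma gdist_None u v :
  gdist u v = None <-> ~~ connect (@edge G) u v.
Proof.
split=> [dN|Nuv].
  apply/connectP => -[p up lp].
  have w : exists m, walk m u v by exists (size p); apply/walkP; exists p.
  have [m wm minm] := ex_minnP w.
  by have /gdistP := conj wm minm; rewrite dN.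
case d: (gdist u v) => [m|] //; move/gdistP: d => [/walkP[p [up lp _]] _].
by case/negP: Nuv; apply/connectP; exists p.
Qed.

Lemma gdist_refl u : gdist u u = Some 0.
Proof. by apply/gdistP; split=> //; apply/walkP; exists [::]. Qed.

Lemma broadcast_dominatingT t r :
  r <= t -> broadcast_dominating t r [set: G].
Proof.
move=> le_rt; apply/forallP => v; rewrite (bigD1 v) ?inE //=.
by rewrite {1}/signal gdist_refl subn0 (leq_trans le_rt) ?leq_addr.
Qed.

Lemma broadcast_numberP t r : r <= t ->
  (exists2 S, broadcast_dominating t r S & #|S| = broadcast_number t r) /\
  (forall S, broadcast_dominating t r S -> broadcast_number t r <= #|S|).
Proof.
move=> /broadcast_dominatingT domT; rewrite /broadcast_number.
by case: arg_minnP => // S domS minS; split=> //; exists S.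
Qed.

End Broadcast.

Definition cyclic_dist (n i j : nat) : nat :=
  minn `|i - j|%N (n - `|i - j|%N).

Definition cycle_power_edge (n k : nat) : rel 'I_n :=
  fun i j => (i != j) && (cyclic_dist n i j <= k).

Lemma cycle_power_edge_sym n k : symmetric (@cycle_power_edge n k).
Proof.
by move=> i j; rewrite /cycle_power_edge /cyclic_dist eq_sym distnC.
Qed.

Lemma cycle_power_edge_irr n k : irreflexive (@cycle_power_edge n k).
Proof. by move=> i; rewrite /cycle_power_edge eqxx. Qed.

Definition cycle_power (n k : nat) : sgraph :=
  SGraph (@cycle_power_edge_sym n k) (@cycle_power_edge_irr n k).

(* Main.v *)
(** A vertex at cyclic distance [x] from a tower receives [t - ceil (x / k)].
    Put [D := (2 * t - r - 1) * k + 1].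

    Upper bounds: two towers whose cyclic distances to [v] add up to at most [D]
    jointly give [v] reception at least [r]; this covers the vertices between
    consecutive towers when all gaps are at most [D].

    Lower bound: cap every signal at [r].  A dominated vertex still receives
    [r] in total, while one tower now emits at most
    [\sum_(j < r) (2 * (k * (t - j - 1)) + 1) = r * D], since at most [2 * x + 1]
    vertices lie within cyclic distance [x].  Double counting gives
    [n <= #|S| * D]. *)

Require Import Defs.
From mathcomp Require Import all_boot all_order all_algebra.
From mathcomp Require Import zify.

Set Implicit Arguments.
Unset Strict Implicit.
Unset Printing Implicit Defensive.

Import GRing.Theory Num.Theory.

Lemma broadcast_number_eq (G : sgraph) (t r m : nat) (S : {set G}) : r <= t ->
  broadcast_dominating t r S -> #|S| <= m ->
  (forall S' : {set G}, broadcast_dominating t r S' -> m <= #|S'|) ->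
  broadcast_number G t r = m.
Proof.
move=> le_rt domS leSm lb; have [[S' /lb lbS' eS'] /(_ _ domS) ubS] :=
  broadcast_numberP G le_rt.
by apply/eqP; rewrite eqn_leq (leq_trans ubS) // -eS'.
Qed.

Section CyclePower.

Variables n k : nat.
Implicit Types u v w : cycle_power n k.

(** * Graph distance and signal strength through cyclic distance *)

Lemma cyclic_dist_triangle (u v w : 'I_n) :
  cyclic_dist n u w <= cyclic_dist n u v + cyclic_dist n v w.
Proof.
rewrite /cyclic_dist.
have := ltn_ord u; have := ltn_ord v; have := ltn_ord w; lia.
Qed.

Lemma walk_cyclic_dist m u v : walk m u v -> cyclic_dist n u v <= k * m.
Proof.
case/walkP=> p [up <- <-] {m v}; elim: p u up => [|w p IHp] u /=.
  by move=> _; rewrite /cyclic_dist distnn min0n.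
case/andP=> /andP[_ uw] /IHp wp.
by rewrite mulnS (leq_trans (cyclic_dist_triangle _ w _)) ?leq_add.
Qed.

(** Moving [k] steps from [u] along the shorter arc cannot overshoot [v]. The case split selects
    that arc and whether the move wraps past 0. *)
Lemma cyclic_dist_step (u v : 'I_n) a : k < cyclic_dist n u v <= k + a ->
  exists w : 'I_n, cyclic_dist n u w <= k /\ cyclic_dist n w v <= a.
Proof.
rewrite /cyclic_dist => uv; have un := ltn_ord u; have vn := ltn_ord v.
suff [w [wn ? ?]] : exists w : nat,
    [/\ w < n, minn `|u - w| (n - `|u - w|) <= k
     & minn `|w - v| (n - `|w - v|) <= a].
  by exists (Ordinal wn).
have [lt_uv|le_vu] := ltnP u v.
  have [d|d] := leqP (v - u) (n - (v - u)); first by exists (u + k); split; lia.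
  by have [uk|uk] := leqP k u; [exists (u - k)|exists (u + n - k)]; split; lia.
have [d|d] := leqP (u - v) (n - (u - v)); first by exists (u - k); split; lia.
by have [uk|uk] := ltnP (u + k) n; [exists (u + k)|exists (u + k - n)]; split; lia.
Qed.

Lemma cyclic_dist_eq0 (u v : 'I_n) : (cyclic_dist n u v == 0) = (u == v).
Proof.
rewrite -val_eqE /cyclic_dist /=; have := ltn_ord u; have := ltn_ord v; lia.
Qed.

Lemma cyclic_dist_walk m u v :
  cyclic_dist n u v <= k * m -> exists2 m', m' <= m & walk m' u v.
Proof.
elim: m u => [|m IHm] u uv.
  exists 0 => //; apply/walkP; exists [::]; split=> //=.
  by apply/eqP; rewrite -cyclic_dist_eq0 -leqn0 -(muln0 k).
have [uvk|uvk] := leqP (cyclic_dist n u v) k.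
  have [->|Nuv] := eqVneq u v; first by exists 0 => //; apply/walkP; exists [::].
  exists 1 => //; apply/walkP; exists [:: v]; split=> //=.
  by rewrite /cycle_power_edge Nuv uvk.
have [|w [uw wv]] := @cyclic_dist_step u v (k * m); first by rewrite uvk -mulnS.
have [m' le_m' /walkP[p [wp lp sp]]] := IHm w wv.
(* [cyclic_dist_step] does not exclude [w = u], where there is no edge; the walk from [w] then
   serves as it is, hence [m' <= m] and not equality. *)
have [euw|Nuw] := eqVneq u w.
  by exists m'; [lia|apply/walkP; exists p; rewrite euw].
exists m'.+1; first by [].
apply/walkP; exists (w :: p); split=> //=; last by rewrite sp.
by rewrite {1}/cycle_power_edge Nuw uw.
Qed.

(** Expresses graph distance as [ceil (x / k)] without division: distance at most [m] means cyclic
    distance at most [k * m]. *)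
Lemma ltn_signal t u v j :
  (j < signal t u v) = (j < t) && (cyclic_dist n u v <= k * (t - j.+1)).
Proof.
rewrite /signal; apply/idP/andP.
  case d: (gdist u v) => [m|] // jt; move/gdistP: d => [/walk_cyclic_dist wm _].
  by split; [lia|rewrite (leq_trans wm) // leq_mul2l; lia].
case=> jt /cyclic_dist_walk[m' le_m' wm'].
case d: (gdist u v) => [m|]; first by move/gdistP: d => [_ /(_ _ wm')]; lia.
move/gdist_None: d; case/negP; case/walkP: wm' => p [up lp _].
by apply/connectP; exists p.
Qed.

(** * Ball sizes and the double count *)

Lemma card_cyclic_ball (u : 'I_n) x :
  #|[set v : 'I_n | cyclic_dist n u v <= x]| <= 2 * x + 1.
Proof.
(* Rotating by [x - u] modulo [n] sends the ball into [[0, 2 * x]], and rotation is injective. *)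
pose h (v : 'I_n) : 'I_(2 * x).+1 := inord ((v + n - u + x) %% n).
set A := [set v | _].
have hA v : v \in A -> (v + n - u + x) %% n < (2 * x).+1.
  rewrite inE /cyclic_dist => uv; have un := ltn_ord u; have vn := ltn_ord v.
  have red z q : v + n - u + x = z + q * n -> z <= 2 * x ->
      (v + n - u + x) %% n < (2 * x).+1.
    by move=> -> zx; rewrite addnC modnMDl ltnS (leq_trans (leq_mod _ _)).
  (* The split tells which of [|u - v|] and [n - |u - v|] is known to be at most [x]; the second
     argument of [red] is the number of full turns removed. *)
  have [vu|vu] := leqP n (`|u - v| + x); last first.
    by apply: (red (v + x - u) 1); lia.
  have [lt_uv|le_vu] := ltnP u v.
    by apply: (red (v + x - u - n) 2); lia.
  by apply: (red (v + n - u + x) 0); lia.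
rewrite addn1 -[leqRHS]card_ord -(@card_in_imset _ _ h) ?max_card // => v w vA wA.
move=> /(congr1 val); rewrite /= !inordK ?hA // => /eqP.
have un := ltn_ord u; have vn := ltn_ord v; have wn := ltn_ord w.
rewrite -!addnBA ?(ltnW un) // -!addnA eqn_modDr !modn_small // => /eqP.
exact: val_inj.
Qed.

Lemma sum_capped_signal t r u : r <= t ->
  \sum_v minn r (signal t u v) <= r * ((2 * t - r - 1) * k + 1).
Proof.
move=> le_rt.
(* Layer by layer: level [j] of the capped signal reaches exactly a cyclic ball. *)
have capE s : minn r s = \sum_(j < r) (j < s).
  elim: r {le_rt} => [|r IHr]; first by rewrite big_ord0 min0n.
  by rewrite big_ord_recr -IHr /=; lia.
under eq_bigr do rewrite capE.
rewrite exchange_big /=.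
apply: (@leq_trans (\sum_(j < r) (2 * (k * (t - j.+1)) + 1))).
  apply: leq_sum => j _; apply: leq_trans (card_cyclic_ball u _).
  rewrite -sum1_card [leqRHS]big_mkcond /=; apply: leq_sum => v _.
  by rewrite inE ltn_signal; case: (cyclic_dist _ _ _ <= _); case: (j < t).
clear capE; elim: r le_rt => [|r IHr] le_rt; first by rewrite big_ord0.
rewrite big_ord_recr /=; apply: leq_trans (leq_add (IHr (ltnW le_rt)) (leqnn _)) _.
have [s ->] : exists s, t = r + 1 + s by exists (t - r.+1); lia.
have -> : 2 * (r + 1 + s) - r - 1 = r + 1 + 2 * s by lia.
have -> : 2 * (r + 1 + s) - r.+1 - 1 = r + 2 * s by lia.
have -> : r + 1 + s - r.+1 = s by lia.
nia.
Qed.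

Lemma card_broadcast_dominating t r (S : {set cycle_power n k}) :
  0 < r <= t -> broadcast_dominating t r S ->
  n <= #|S| * ((2 * t - r - 1) * k + 1).
Proof.
case/andP=> r_gt0 le_rt /forallP domS.
rewrite -(leq_pmul2l r_gt0) mulnCA -sum_nat_const.
apply: (@leq_trans (\sum_(u in S) \sum_v minn r (signal t u v))); last first.
  by apply: leq_sum => u _; apply: sum_capped_signal.
rewrite exchange_big mulnC -[X in X * _](card_ord n) -sum_nat_const /=.
(* Capping is subadditive, so a total of at least [r] survives capping each term. *)
apply: leq_sum => v _; apply: leq_trans (_ : minn r (\sum_(u in S) signal t u v) <= _).
  by rewrite leq_min leqnn; apply: domS.
elim/big_rec2: _ => [|u a b _]; first by rewrite minn0.
by lia.
Qed.

(** If [s1 + s2 < r], both signals are below [t], and each distance exceeds [k * (t - s - 1)] for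
    its signal [s]. Two strict integer bounds add 2, so the distances sum to at least
    [(2 * t - r - 1) * k + 2]. *)
Lemma two_tower_reception t r (S : {set cycle_power n k}) u1 u2 v :
  0 < k -> r <= t -> u1 \in S -> u2 \in S -> u1 != u2 ->
  cyclic_dist n u1 v + cyclic_dist n u2 v <= (2 * t - r - 1) * k + 1 ->
  r <= \sum_(u in S) signal t u v.
Proof.
move=> k_gt0 le_rt u1S u2S Nu12 dle.
rewrite (bigD1 u1) //= (bigD1 u2) /=; last by rewrite u2S eq_sym.
rewrite addnA; apply: leq_trans (leq_addr _ _).
rewrite leqNgt; apply/negP => lt_r.
have sig u : signal t u v < t -> k * (t - (signal t u v).+1) < cyclic_dist n u v.
  by move=> lt_t; rewrite ltnNge; have := ltn_signal t u v (signal t u v);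
    rewrite ltnn lt_t /= => <-.
move: (sig u1) (sig u2); set s1 := signal t u1 v in lt_r *; set s2 := signal t u2 v in lt_r *.
move=> /(_ ltac:(lia)) h1 /(_ ltac:(lia)) h2.
have : k * (2 * t - r - 1) <= k * (t - s1.+1) + k * (t - s2.+1).
  by rewrite -mulnDr leq_mul2l; lia.
lia.
Qed.

End CyclePower.

Lemma ceil_divn_nat (n d m : nat) : m * d < n <= m.+1 * d ->
  Num.ceil (n%:R / d%:R : rat)%R = m.+1.
Proof.
case/andP=> lo hi; have d_gt0 : 0 < d by lia.
apply: ceil_def; rewrite intS addrC addKr.
by rewrite ltr_pdivlMr ?ler_pdivrMr ?ltr0n // -!natrM ltr_nat ler_nat lo.
Qed.

Theorem theorem3 (n k t r : nat)
    (hn : 1 <= n) (hk : 1 <= k) (hr : 1 <= r) (hrt : r <= t) :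
  [/\ n <= 2 * (t - r) * k + 1 ->
        broadcast_number (cycle_power n k) t r = 1,
      2 * (t - r) * k + 1 < n <= (2 * t - r - 1) * k + 1 ->
        broadcast_number (cycle_power n k) t r = 2
    & (2 * t - r - 1) * k + 1 < n ->
        Posz (broadcast_number (cycle_power n k) t r) =
        Num.ceil (n%:R / ((2 * t - r - 1) * k + 1)%:R : rat)%R].
Proof.
have hrt' : 0 < r <= t by rewrite hr.
have card_gt0 (S : {set cycle_power n k}) : broadcast_dominating t r S -> 0 < #|S|.
  by move=> /(card_broadcast_dominating hrt'); case: #|S| => //; lia.
pose z : cycle_power n k := Ordinal hn.
split.
- move=> le_n; apply: (@broadcast_number_eq _ _ _ _ [set z]) => //; last first.
    by rewrite cards1.
  apply/forallP => v; rewrite big_set1 -(prednK hr) ltn_signal.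
  rewrite (leq_trans _ hrt) ?prednK // /cyclic_dist /= dist0n mulnC.
  rewrite -mulnA in le_n; move: ((t - r) * k) le_n => a le_n.
  by have vn : v < n := ltn_ord v; lia.
- case/andP=> lt_n le_n; have n1 : 1 < n by apply: leq_ltn_trans lt_n; rewrite addn1.
  (* Any second tower would do: each cyclic distance is at most [n / 2], so two of them sum to at
     most [n]. *)
  pose y : cycle_power n k := Ordinal n1.
  apply: (@broadcast_number_eq _ _ _ _ [set z; y]) => //.
  + apply/forallP => v; apply: (@two_tower_reception _ _ _ _ _ z y) => //.
    * by rewrite !inE eqxx.
    * by rewrite !inE eqxx orbT.
    * by have vn : v < n := ltn_ord v;
        apply: leq_trans le_n; rewrite /cyclic_dist /=; lia.
  + by rewrite cards2; case: (_ != _).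
  move=> S domS; rewrite ltn_neqAle card_gt0 // andbT eq_sym.
  apply/negP => /cards1P[u eS].
  (* The vertex [(t - r) * k + 1] places after [u] is too far both ways round, as [n] is at least
     [2 * (t - r) * k + 2]. *)
  have [v far] : exists v : 'I_n, (t - r) * k < cyclic_dist n u v.
    have un : u < n := ltn_ord u.
    rewrite -mulnA in lt_n; move: ((t - r) * k) lt_n => a lt_n.
    rewrite /cyclic_dist; have [ok|ok] := ltnP (u + a.+1) n.
      by exists (Ordinal ok) => /=; lia.
    have ok' : u + a.+1 - n < n by lia.
    by exists (Ordinal ok') => /=; lia.
  move/forallP: domS => /(_ v).
  rewrite eS big_set1 -(prednK hr) ltn_signal prednK //.
  by case/andP=> _; rewrite mulnC leqNgt far.
- set D := (2 * t - r - 1) * k + 1 => lt_Dn.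
  have D_gt0 : 0 < D by rewrite /D addn1.
  (* The predecessor makes [m.+1] the ceiling of [n / D] even when [D] divides [n]. *)
  pose m := n.-1 %/ D.
  have lo : m * D < n by have := leq_trunc_div n.-1 D; lia.
  have hi : n <= m.+1 * D by have := ltn_ceil n.-1 D_gt0; lia.
  rewrite (@ceil_divn_nat _ _ m) ?lo ?hi //; congr Posz.
  (* Towers stand at the multiples of [D]; the closing gap [n - m * D] is at most [D]. The default
     [z] is never taken, since [m * D < n]. *)
  pose f (i : 'I_m.+1) : cycle_power n k := insubd (z : 'I_n) (i * D).
  have fE i : val (f i) = i * D.
    by rewrite val_insubd ifT // (leq_ltn_trans _ lo) // leq_mul2r leq_ord orbT.
  apply: (@broadcast_number_eq _ _ _ _ [set f i | i : 'I_m.+1]) => //; last first.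
  + move=> S /(card_broadcast_dominating hrt') le_n.
    by have := leq_trans lo le_n; rewrite ltn_mul2r => /andP[].
  + by rewrite (leq_trans (leq_imset_card _ _)) ?card_ord.
  apply/forallP => v.
  have vn := ltn_ord v; have m_gt0 : 0 < m by nia.
  have lo_v := leq_trunc_div v D; have hi_v := ltn_ceil v D_gt0.
  move: (v %/ D) lo_v hi_v => q lo_v hi_v.
  have le_qm : q <= m by nia.
  have q_lt : q < m.+1 by [].
  (* The next tower around the cycle, distinct from tower [q] because [m > 0]. *)
  pose q' := if q == m then 0 else q.+1.
  have q'_lt : q' < m.+1 by rewrite /q'; case: eqP; lia.
  apply: (@two_tower_reception _ _ _ _ _
    (f (Ordinal q_lt)) (f (Ordinal q'_lt))) => //.
  + exact: imset_f.
  + exact: imset_f.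
  + rewrite -val_eqE !fE /= eqn_mul2r negb_or -lt0n D_gt0 /= /q'.
    by have [->|_] := eqVneq q m; [rewrite -lt0n | lia].
  (* The two arcs from [v] to its neighbouring towers fill one gap, of length at most [D]. *)
  rewrite -/D /cyclic_dist !fE /= /q'.
  case: eqP => [eqm|neqm].
    by rewrite eqm in lo_v hi_v *; lia.
  by rewrite mulSn in hi_v *; lia.
Qed.
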